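(* Let $\mathsf{L}'$, $\mathsf{L}$, $\mathsf{H}'$, $\mathsf{H}$ be simplicial complexes, and let $\mathsf{L}'\to\mathsf{L}$ and $\mathsf{H}'\to\mathsf{H}$ be facet simplicial maps. (1) We have $$\mathrm{C}(\mathsf{L}';\mathsf{H})\leq \mathrm{C}(\mathsf{L};\mathsf{H})\leq \mathrm{C}(\mathsf{L};\mathsf{H}').$$ (2) Moreover, if $\mathsf{L}'\to\mathsf{L}$ and $\mathsf{H}'\to\mathsf{H}$ are injective, then $$\mathrm{IC}(\mathsf{L}';\mathsf{H})\leq \mathrm{IC}(\mathsf{L};\mathsf{H})\leq \mathrm{IC}(\mathsf{L};\mathsf{H}').$$
   Context: A simplicial complex is an abstract simplicial complex: a set $\mathsf{K}$ of subsets (simplices) of a vertex set $V(\mathsf{K})=\bigcup\mathsf{K}$ such that $F\in\mathsf{K}$ and $G\subseteq F$ imply $G\in\mathsf{K}$. A facet is a simplex that is maximal with respect to inclusion; a facet is non-unitary if it has at least two vertices. A subcomplex of $\mathsf{K}$ is a simplicial complex contained in $\mathsf{K}$. The union of simplicial complexes is the union of their vertex sets and of their sets of simplices. A simplicial map $f:\mathsf{L}\to\mathsf{K}$ is a map $f:V(\mathsf{L})\to V(\mathsf{K})$ such that $f(F)\in\mathsf{K}$ whenever $F\in\mathsf{L}$; it is injective if it is injective on vertices. A facet simplicial map is a simplicial map $f:\mathsf{L}\to\mathsf{K}$ such that $f(F)$ is a non-unitary facet of $\mathsf{K}$ whenever $F$ is a non-unitary facet of $\mathsf{L}$. The facet-complexity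 $\mathrm{C}(\mathsf{L};\mathsf{K})$ is the least positive integer $k$ such that there exist subcomplexes $\mathsf{L}_1,\ldots,\mathsf{L}_k$ of $\mathsf{L}$ with $\mathsf{L}=\mathsf{L}_1\cup\cdots\cup\mathsf{L}_k$ and, for each $i$, a facet simplicial map $f_i:\mathsf{L}_i\to\mathsf{K}$; it is $\infty$ if no such $k$ exists. The injective facet-complexity $\mathrm{IC}(\mathsf{L};\mathsf{K})$ is defined in the same way, requiring each $f_i$ to be an injective facet simplicial map. *)

(* Defs.v *)
From mathcomp Require Import all_boot all_order all_algebra.
From mathcomp Require Import all_classical all_reals.

Set Implicit Arguments.
Unset Strict Implicit.
Unset Printing Implicit Defensive.

Local Open Scope classical_set_scope.

Record complex (T : Type) := Complex {
  simplices : set (set T);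
  simplices_sub : forall F G : set T, simplices F -> G `<=` F -> simplices G
}.

Definition vertices (T : Type) (K : complex T) : set T :=
  \bigcup_(F in simplices K) F.

Definition facet (T : Type) (K : complex T) (F : set T) : Prop :=
  simplices K F /\ (forall G : set T, simplices K G -> F `<=` G -> G = F).

Definition nonunitary_facet (T : Type) (K : complex T) (F : set T) : Prop :=
  facet K F /\ (exists x y : T, [/\ F x, F y & x <> y]).

(* Maps are defined on the vertex set only ([vertices K] is coerced to a     *)
(* type): a total function T -> U would wrongly fail to exist when K has no   *)
(* vertices and U is empty. [vimage f F] is the image f(F) as a set in U.     *)
Definition vimage (T U : Type) (K : complex T) (M : complex U)
    (f : vertices K -> vertices M) (F : set T) : set U :=
  [set \val (f x) | x in [set x : vertices K | F (\val x)]].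

Definition simplicial_map (T U : Type) (K : complex T) (M : complex U)
    (f : vertices K -> vertices M) : Prop :=
  forall F : set T, simplices K F -> simplices M (vimage f F).

Definition facet_simplicial_map (T U : Type) (K : complex T) (M : complex U)
    (f : vertices K -> vertices M) : Prop :=
  simplicial_map f /\
  (forall F : set T, nonunitary_facet K F -> nonunitary_facet M (vimage f F)).

Definition covered_by (T : Type) (P : complex T -> Prop) (L : complex T)
    (k : nat) : Prop :=
  exists Ls : 'I_k -> complex T,
    [/\ forall i, simplices (Ls i) `<=` simplices L,
        simplices L = \bigcup_i simplices (Ls i)
      & forall i, P (Ls i)].

(* The least positive integer satisfying Q, and +oo if there is none; the     *)
(* values lie in [\bar int] to use the library order on extended numbers.     *)
Definition least_positive (Q : nat -> Prop) : \bar int :=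
  match pselect (exists k : nat, (0 < k)%N && `[< Q k >]) with
  | left exQ => (Posz (ex_minn exQ))%:E
  | right _ => +oo%E
  end.

Definition facet_complexity (T U : Type) (L : complex T) (K : complex U) :
    \bar int :=
  least_positive (covered_by (fun M : complex T =>
    exists f : vertices M -> vertices K, facet_simplicial_map f) L).

Definition injective_facet_complexity (T U : Type) (L : complex T)
    (K : complex U) : \bar int :=
  least_positive (covered_by (fun M : complex T =>
    exists f : vertices M -> vertices K,
      facet_simplicial_map f /\ injective f) L).

(* Main.v *)
Require Import Defs.
From mathcomp Require Import all_boot all_order all_algebra.
From mathcomp Require Import all_classical all_reals.

(** Post-composition with [h] gives the right-hand inequalities. For the
    left-hand ones a cover [L_i] of [L] has to be pulled back along [f]. The
    preimages [f^-1(L_i)] may have facets that are not facets of [L'], so we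
    take instead the complex of the simplices of [L'] lying below some [G] all
    of whose cofaces are mapped into [L_i]. A facet of it is a facet of [L'],
    and finiteness of the cover makes these complexes cover [L'], even when
    simplices are infinite or lie in no facet. *)

Set Implicit Arguments.
Unset Strict Implicit.
Unset Printing Implicit Defensive.

Local Open Scope classical_set_scope.

Lemma vertices_simplex (T : Type) (K : complex T) (F : set T) (x : T) :
  simplices K F -> F x -> x \in vertices K.
Proof. by move=> KF Fx; apply/mem_set; exists F. Qed.

Lemma vimageS (T U : Type) (K : complex T) (M : complex U)
    (f : vertices K -> vertices M) (F G : set T) :
  F `<=` G -> vimage f F `<=` vimage f G.
Proof. by move=> FG _ [x Fx <-]; exists x => //; exact: FG. Qed.

Lemma vimage_comp (T U V : Type) (K : complex T) (M : complex U)
    (N : complex V) (f : vertices K -> vertices M)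
    (g : vertices M -> vertices N) (F : set T) :
  vimage (g \o f) F = vimage g (vimage f F).
Proof.
apply/seteqP; split => [_ [x Fx <-]|_ [y [x Fx /val_inj <-] <-]].
  by exists (f x) => //; exists x.
by exists x.
Qed.

Lemma facet_simplicial_map_comp (T U V : Type) (K : complex T) (M : complex U)
    (N : complex V) (f : vertices K -> vertices M)
    (g : vertices M -> vertices N) :
  facet_simplicial_map f -> facet_simplicial_map g ->
  facet_simplicial_map (g \o f).
Proof.
move=> [f_simp f_facet] [g_simp g_facet]; split=> F KF; rewrite vimage_comp.
  exact/g_simp/f_simp.
exact/g_facet/f_facet.
Qed.

Lemma nonunitary_facet_sub (T : Type) (K M : complex T) (F : set T) :
  simplices M `<=` simplices K -> simplices M F ->
  nonunitary_facet K F -> nonunitary_facet M F.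
Proof.
move=> MK MF [[_ Fmax] F2]; split=> //; split=> // G /MK; exact: Fmax.
Qed.

(** A non-unitary facet of [K0] is one of [K] by the last hypothesis, so [f] sends it to a
    non-unitary facet of [M]. That image lies in [M0], and maximality in [M] passes to the
    subcomplex. *)
Lemma facet_simplicial_map_restrict (T U : Type) (K K0 : complex T)
    (M M0 : complex U) (f : vertices K -> vertices M) :
    facet_simplicial_map f ->
    simplices K0 `<=` simplices K -> simplices M0 `<=` simplices M ->
    (forall F, simplices K0 F -> simplices M0 (vimage f F)) ->
    (forall F, facet K0 F -> facet K F) ->
  exists r : vertices K0 -> vertices M0,
    facet_simplicial_map r /\ (injective f -> injective r).
Proof.
move=> [f_simp f_facet] K0K M0M f_restr K0_facet.
have inK (x : vertices K0) : \val x \in vertices K.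
  by have [F /K0K KF Fx] := set_mem (valP x); exact: vertices_simplex KF Fx.
pose incl (x : vertices K0) : vertices K := exist _ (\val x) (inK x).
have inM0 (x : vertices K0) : \val (f (incl x)) \in vertices M0.
  have [F K0F Fx] := set_mem (valP x).
  by apply: (vertices_simplex (f_restr _ K0F)); exists (incl x).
pose r (x : vertices K0) : vertices M0 := exist _ (\val (f (incl x))) (inM0 x).
(* For an arbitrary [F] the right side could be larger, through points of [F] that are vertices of
   [K] but not of [K0]. *)
have vimage_r F : simplices K0 F -> vimage r F = vimage f F.
  move=> K0F; apply/seteqP; split => [_ [x Fx <-]|_ [x Fx <-]].
    by exists (incl x).
  have xK0 : \val x \in vertices K0 by exact: vertices_simplex K0F Fx.
  exists (exist _ (\val x) xK0) => //=.
  by congr (\val (f _)); exact: val_inj.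
exists r; split; first split=> F.
- by move=> K0F; rewrite vimage_r//; exact: f_restr.
- move=> [K0F_facet F2]; have [K0F _] := K0F_facet; rewrite vimage_r//.
  apply: (nonunitary_facet_sub M0M); first exact: f_restr.
  by apply: f_facet; split=> //; exact: K0_facet.
move=> f_inj x y /(congr1 \val) /= /val_inj/f_inj/(congr1 \val) /=.
exact: val_inj.
Qed.

Lemma finite_cover_above (T : Type) (I : eqType) (K : complex T)
    (S : I -> set (set T)) :
    (forall i F G, F `<=` G -> S i G -> S i F) ->
  forall (s : seq I) (F : set T), simplices K F ->
    (forall G, simplices K G -> F `<=` G -> exists2 i, i \in s & S i G) ->
  exists i G, [/\ simplices K G, F `<=` G &
    forall G', simplices K G' -> G `<=` G' -> S i G'].
Proof.
move=> S_down; elim=> [|i s IHs] F KF cover_s.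
  by have [] := cover_s F KF (@subset_refl _ F).
have [[G [KG FG nSG]]|S_above] :=
    pselect (exists G, [/\ simplices K G, F `<=` G & ~ S i G]); last first.
  exists i, F; split=> // G KG FG.
  by apply: contrapT => nSG; apply: S_above; exists G.
have [G' KG' GG'|j [G' [KG' GG' S_G']]] := IHs G KG.
  have [j] := cover_s G' KG' (subset_trans FG GG').
  rewrite inE => /orP[/eqP-> SG'|sj SG']; last by exists j.
  by case: nSG; exact: S_down GG' SG'.
by exists j, G'; split=> //; exact: subset_trans FG GG'.
Qed.

Section StablePreimage.
Variables (T : Type) (K : complex T) (S : set (set T)).

(** The condition on [G] is closed upwards in [K], which makes facets behave well; passing to all
    [F] below such a [G] restores closure under subsets. *)
Definition stable_simplices : set (set T) :=
  [set F | exists G, [/\ simplices K G, F `<=` G &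
    forall G', simplices K G' -> G `<=` G' -> S G']].

Lemma stable_simplices_sub (F G : set T) :
  stable_simplices F -> G `<=` F -> stable_simplices G.
Proof.
by move=> [H [KH FH SH]] GF; exists H; split=> //; exact: subset_trans FH.
Qed.

Definition stable_complex : complex T := Complex stable_simplices_sub.

Lemma stable_complex_sub : simplices stable_complex `<=` simplices K.
Proof. by move=> F [G [KG FG _]]; exact: simplices_sub KG FG. Qed.

(** By maximality [F] is its own witness [G]. Any simplex [H] of [K] above [F] then inherits the
    condition, so it lies in the stable complex and equals [F]. *)
Lemma facet_stable_complex (F : set T) : facet stable_complex F -> facet K F.
Proof.
move=> [SF Fmax]; split=> [|H KH FH]; first exact: stable_complex_sub.
have [G [KG FG SG]] := SF.
have GF : G = F by apply: Fmax => //; exists G; split.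
apply: Fmax => //; exists H; split=> // H' KH' HH'.
by apply: SG => //; rewrite GF; exact: subset_trans FH HH'.
Qed.

End StablePreimage.

(** [P] and [P'] are left abstract so that the plain and the injective complexity are treated at
    once. *)
Lemma covered_by_pullback (T' T : Type) (L' : complex T') (L : complex T)
    (f : vertices L' -> vertices L) (P' : complex T' -> Prop)
    (P : complex T -> Prop) (k : nat) :
    facet_simplicial_map f ->
    (forall M' M (r : vertices M' -> vertices M), facet_simplicial_map r ->
      (injective f -> injective r) -> P M -> P' M') ->
  covered_by P L k -> covered_by P' L' k.
Proof.
move=> f_facet PP' [Ls [LsL coverL PLs]].
pose S i : set (set T') := [set F | simplices (Ls i) (vimage f F)].
have S_down i F G : F `<=` G -> S i G -> S i F.
  by move=> FG SG; apply: simplices_sub SG _; exact: vimageS.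
exists (fun i => stable_complex L' (S i)); split=> [i||i].
- exact: stable_complex_sub.
- apply/seteqP; split=> [F L'F|F [i _]]; last exact: stable_complex_sub.
  have [G L'G _|i [G stableG]] :=
      finite_cover_above S_down (s := enum 'I_k) L'F.
    have := f_facet.1 _ L'G; rewrite coverL => -[i _ SiG].
    by exists i => //; rewrite mem_enum.
  by exists i => //; exists G.
have [//|F [G [L'G FG SG]]|F|r [r_facet r_inj]] :=
    @facet_simplicial_map_restrict _ _ L' (stable_complex L' (S i)) L (Ls i) f
      f_facet (@stable_complex_sub _ _ _).
(* [G] lies above itself, so its image is in [Ls i], and with it the image of [F]. *)
- by apply: S_down FG _; exact: SG.
- exact: facet_stable_complex.
exact: PP' r_facet r_inj (PLs i).
Qed.

Lemma covered_byW (T : Type) (P Q : complex T -> Prop) (L : complex T)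
    (k : nat) :
  (forall M, P M -> Q M) -> covered_by P L k -> covered_by Q L k.
Proof.
by move=> PQ [Ls [LsL coverL PLs]]; exists Ls; split=> // i; exact: PQ.
Qed.

(** Reduces each inequality to turning a cover by [k] pieces into another by the same number [k]. If
    no positive [k] satisfies [Q'], the right side is infinite. *)
Lemma least_positive_le (Q Q' : nat -> Prop) :
  (forall k, Q' k -> Q k) -> (least_positive Q <= least_positive Q')%E.
Proof.
move=> Q'Q; rewrite /least_positive.
case: (pselect (exists k, (0 < k)%N && `[< Q' k >])) => [exQ'|_]; last first.
  by rewrite leey.
have [k /andP[k_gt0 /asboolP Q'k] _] := ex_minnP exQ'.
have Qk : (0 < k)%N && `[< Q k >] by rewrite k_gt0; apply/asboolP; exact: Q'Q.
case: pselect => [exQ|[]]; last by exists k.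
by have [m _ /(_ k Qk) le_mk] := ex_minnP exQ; rewrite lee_fin lez_nat.
Qed.

Theorem theorem3p8 (T' T U' U : Type)
    (L' : complex T') (L : complex T) (H' : complex U') (H : complex U)
    (f : vertices L' -> vertices L) (h : vertices H' -> vertices H)
    (hf : facet_simplicial_map f) (hh : facet_simplicial_map h) :
  ((facet_complexity L' H <= facet_complexity L H)%E /\
   (facet_complexity L H <= facet_complexity L H')%E) /\
  (injective f -> injective h ->
   (injective_facet_complexity L' H <= injective_facet_complexity L H)%E /\
   (injective_facet_complexity L H <= injective_facet_complexity L H')%E).
Proof.
split=> [|f_inj h_inj]; split; apply: least_positive_le => k.
- apply: covered_by_pullback hf _ => M' M r r_facet _ [g g_facet].
  by exists (g \o r); exact: facet_simplicial_map_comp.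
(* The cover of [L] is kept; only the maps on its pieces change. *)
- apply: covered_byW => M [g g_facet].
  by exists (h \o g); exact: facet_simplicial_map_comp.
- apply: covered_by_pullback hf _ => M' M r r_facet r_inj [g [g_facet g_inj]].
  exists (g \o r); split; first exact: facet_simplicial_map_comp.
  exact: inj_comp g_inj (r_inj f_inj).
- apply: covered_byW => M [g [g_facet g_inj]].
  exists (h \o g); split; first exact: facet_simplicial_map_comp.
  exact: inj_comp h_inj g_inj.
Qed.
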